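(* Let $C$ and $D$ be cycles in the graph $G$ that have more than one vertex in common. There exists a unique cycle $E$ consisting only of edges of $C$ and $D$ with the following properties: (i) The interior of $E$ contains the interior of both $C$ and $D$. (ii) If an edge $e$ belongs to $C$ or $D$, then either $e$ belongs to $E$ or $e$ is contained in the interior of $E$. Moreover, if $D$ contains at least one edge in the exterior of $C$, then the cycle $E$ also contains an edge of $D$ that lies in the exterior of $C$.
   Context: $\mathbb{R}^2$ is tiled into unit squares $\{S_k\}_{k\ge 0}$ with disjoint interiors, the axis-parallel unit squares centred at the points of $\mathbb{Z}^2$. $G$ is the graph whose vertices are the corners of the squares $S_k$ and whose edges are the (unit length) edges of the squares $S_k$, $k\ge 0$. A cycle is a simple (non-self-intersecting) cycle of $G$, i.e. every vertex of the cycle is an endvertex of exactly two of its edges. A cycle divides the plane into a bounded connected region, its interior, and an unbounded connected region, its exterior. A square lies in the interior (resp. exterior) of a cycle if its open square is contained in the interior (resp. exterior) of the cycle. An edge $e$ is contained in the interior (resp. exterior) of a cycle if both squares of $\{S_k\}$ having $e$ as an edge lie in the interior (resp. exterior) of the cycle. *)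

(* Defs.v *)
From HB Require Import structures.
From mathcomp Require Import all_boot all_order all_algebra finmap.
From mathcomp Require Import all_classical all_reals all_analysis.

Set Implicit Arguments.
Unset Strict Implicit.
Unset Printing Implicit Defensive.

Import Order.TTheory GRing.Theory Num.Theory.
Import numFieldNormedType.Exports.

Local Open Scope classical_set_scope.
Local Open Scope ring_scope.

(* The square [s : square] is the unit square centred at the point [s] of Z^2;
   the vertex [v : vertex] is the point [v + (1/2, 1/2)]. *)
Definition square : Type := (int * int)%type.
Definition vertex := (int * int)%type.

Definition corner (s : square) (v : vertex) : bool :=
  (v.1 \in [:: s.1 - 1; s.1]) && (v.2 \in [:: s.2 - 1; s.2]).

Definition adj : rel vertex :=
  fun u v => `|u.1 - v.1| + `|u.2 - v.2| == 1.

(* An edge of G is an unordered pair [fset u; v] with [adj u v]. *)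
Definition edge := {fset vertex}.

(* For an edge of G (a pair of vertices at distance 1) this says that it is one
   of the four sides of [s]; every edge of G is a side of exactly two squares. *)
Definition side (s : square) (e : edge) : Prop :=
  forall v : vertex, v \in e -> corner s v.

(* A cycle is identified with its set of edges, so that the choice of a starting
   vertex and of a direction is immaterial. *)
Definition is_cycle (E : {fset edge}) : Prop :=
  exists c : seq vertex,
    [/\ (2 < size c)%N, ucycle adj c
      & E = [fset [fset v; next c v]%fset | v in c]%fset].

Definition vertices (E : {fset edge}) : {fset vertex} :=
  (\bigcup_(e <- E) e)%fset.

Section Plane.
Variable R : realType.

(* R^o is R seen as a normed vector space over itself. *)
Local Notation plane := (R^o * R^o)%type.

Definition vpoint (v : vertex) : plane := (v.1%:~R + 2^-1, v.2%:~R + 2^-1).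

Definition open_square (s : square) : set plane :=
  [set p | `|p.1 - s.1%:~R : R| < 2^-1 /\ `|p.2 - s.2%:~R : R| < 2^-1].

Definition segment (a b : plane) : set plane :=
  [set (1 - t) *: a + t *: b | t in [set t : R | 0 <= t <= 1]].

(* The closed curve in the plane drawn by the edges of [E]. *)
Definition trace (E : {fset edge}) : set plane :=
  [set p | exists u v : vertex,
     [fset u; v]%fset \in E /\ segment (vpoint u) (vpoint v) p].

(* Interior and exterior are the unions of the bounded, resp. unbounded,
   connected components of the complement of the curve (by the Jordan curve
   theorem there is exactly one of each). *)
Definition cycle_interior (E : {fset edge}) : set plane :=
  [set p | ~ trace E p /\ bounded_set (connected_component (~` trace E) p)].

Definition cycle_exterior (E : {fset edge}) : set plane :=
  [set p | ~ trace E p /\ ~ bounded_set (connected_component (~` trace E) p)].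

Definition edge_in_interior (E : {fset edge}) (e : edge) : Prop :=
  forall s : square, side s e -> open_square s `<=` cycle_interior E.

Definition edge_in_exterior (E : {fset edge}) (e : edge) : Prop :=
  forall s : square, side s e -> open_square s `<=` cycle_exterior E.

End Plane.

Arguments cycle_interior R E : clear implicits.
Arguments cycle_exterior R E : clear implicits.
Arguments edge_in_interior R E e : clear implicits.
Arguments edge_in_exterior R E e : clear implicits.

(* Main.v *)
Require Import Defs.
From HB Require Import structures.
From mathcomp Require Import all_boot all_order all_algebra finmap.
From mathcomp Require Import all_classical all_reals all_analysis.
From mathcomp Require Import zify ring lra.

Set Implicit Arguments.
Unset Strict Implicit.
Unset Printing Implicit Defensive.

Import Order.TTheory GRing.Theory Num.Theory.
Import numFieldNormedType.Exports.

Local Open Scope classical_set_scope.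
Local Open Scope ring_scope.

(* A square is inside a cycle when a ray leaving its centre crosses the cycle an odd
   number of times. Squares linked by a path of squares crossing no edge of the
   cycle have the same parity; conversely the squares on the left of a cycle are all
   linked, so are those on its right, and every square is linked to one of these, so
   parity characterises the two classes. Hence parity decides whether the component
   of a point in the complement of the curve is bounded.

   Call a cycle F drawn on C and D maximal if it encloses the largest number of
   squares. An edge e of C, say, outside F lies on an arc of C with both ends on F
   and no other point on F. This arc and F form a theta graph, one cycle of which
   encloses F and more squares, a contradiction. So every edge of C and D is on F
   or inside F. Whenever all edges of G are on F or inside F, no path outside F
   crosses G, and F encloses all that G encloses; this gives (i), uniqueness,
   and, with C and E in place of F and G, that E has an edge outside C if D has one. *)

(** * Steps of a cycle and crossing parity *)

Section Steps.
Variable T : choiceType.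
Implicit Types (x y : T) (s c : seq T).

(** Edges are oriented pairs listed in order of traversal, so that crossings can be counted and the
    count splits over concatenated arcs. *)
Fixpoint steps x s : seq (T * T) :=
  if s is y :: s' then (x, y) :: steps y s' else [::].

Definition csteps c : seq (T * T) :=
  if c is x :: s then steps x (rcons s x) else [::].

Lemma steps_cat x s1 s2 :
  steps x (s1 ++ s2) = steps x s1 ++ steps (last x s1) s2.
Proof. by elim: s1 x => //= y s1 IH x; rewrite IH. Qed.

Lemma steps_rcons x s y : steps x (rcons s y) = rcons (steps x s) (last x s, y).
Proof. by rewrite -cats1 steps_cat cats1. Qed.

Lemma path_steps (e : rel T) x s : path e x s = all (fun p => e p.1 p.2) (steps x s).
Proof. by elim: s x => //= y s IH x; rewrite IH. Qed.

Lemma cycle_csteps (e : rel T) c : cycle e c = all (fun p => e p.1 p.2) (csteps c).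
Proof. by case: c => //= x s; rewrite path_steps. Qed.

(** Serves to run an arc backwards without changing its unoriented edges. *)
Lemma perm_steps_rev x s y :
  perm_eq (steps y (rcons (rev s) x)) [seq (p.2, p.1) | p <- steps x (rcons s y)].
Proof.
elim: s x y => [|z s IH] x y //=.
by rewrite rev_cons steps_rcons last_rcons perm_rcons perm_cons IH.
Qed.

Lemma csteps_next c : uniq c -> csteps c = [seq (v, next c v) | v <- c].
Proof.
move=> Uc; have := cycle_next Uc; case: c Uc => // x s _.
rewrite [cycle _ _]/= [csteps _]/=; move: (next (x :: s)) => f.
suff H y : fpath f y (rcons s x) -> steps y (rcons s x) = [seq (v, f v) | v <- y :: s].
  exact: H.
by elim: s y => [|z s IH] y /= /andP[/eqP -> //] /IH ->.
Qed.

Lemma csteps_map_fst c : [seq p.1 | p <- csteps c] = c.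
Proof.
case: c => //= x s; move: {2}x => y.
by elim: s x => //= z s IH x; rewrite IH.
Qed.

Lemma csteps_uniq c : uniq c -> uniq (csteps c).
Proof. by move=> Uc; apply: (@map_uniq _ _ fst); rewrite csteps_map_fst. Qed.

Lemma mem_csteps c u v : uniq c -> ((u, v) \in csteps c) = (u \in c) && (v == next c u).
Proof.
move=> Uc; rewrite csteps_next //; apply/mapP/andP => [[z zc [-> ->]]|[uc /eqP ->]] //.
by exists u.
Qed.

(* [{u, v}] is an edge of the cycle [c]. *)
Definition cedge c u v := ((u, v) \in csteps c) || ((v, u) \in csteps c).

Lemma cedge_sym c u v : cedge c u v = cedge c v u.
Proof. by rewrite /cedge orbC. Qed.

Lemma cedgeE c u v : uniq c -> u \in c ->
  cedge c u v = (v == next c u) || (v == prev c u).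
Proof.
move=> Uc uc; rewrite /cedge !mem_csteps // uc /=; congr orb.
apply/andP/eqP => [[vc /eqP ->]|->]; first by rewrite prev_next.
by rewrite mem_prev next_prev.
Qed.

Lemma cedge_mem c u v : uniq c -> cedge c u v -> (u \in c) && (v \in c).
Proof.
move=> Uc; rewrite /cedge !mem_csteps //.
by case/orP => /andP[zc /eqP ->]; rewrite zc mem_next zc.
Qed.

Lemma fset2_eq (u v a b : T) :
  ([fset u; v] == [fset a; b])%fset = ((u, v) == (a, b)) || ((u, v) == (b, a)).
Proof.
apply/eqP/orP => [|[/eqP[-> ->]|/eqP[-> ->]]] //; last by rewrite fsetUC.
move=> /fsetP E; have := (E u, E v, E a, E b).
rewrite !inE !eqxx /= !orbT !(eq_sym a) !(eq_sym b) !xpair_eqE.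
move=> [[[]]].
by case: (u == a); case: (u == b); case: (v == a); case: (v == b) => //=; auto.
Qed.

(** Rotating [c] to start at [x] makes it a path along which [Q] spreads. *)
Lemma cycle_ind c (Q : T -> Prop) x : uniq c ->
  (forall v, v \in c -> Q v -> Q (next c v)) ->
  x \in c -> Q x -> forall v, v \in c -> Q v.
Proof.
move=> Uc Qn xc Qx; case: (rot_to xc) => i s Ec.
have Uc' : uniq (x :: s) by rewrite -Ec rot_uniq.
have := cycle_next Uc'; rewrite /= -Ec => P.
suff H : forall z t, z \in c -> Q z -> fpath (next c) z t ->
    forall v, v \in z :: t -> Q v.
  move=> v vc; apply: (H x s) => //.
    move: P; rewrite rcons_path => /andP[P _].
    by apply: sub_path P => y z /=; rewrite next_rot.
  by rewrite -Ec mem_rot.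
move=> z t; elim: t z => [|y t IH] z zc Qz /=.
  by move=> _ v; rewrite inE => /eqP ->.
move=> /andP[/eqP E Pt] v; rewrite inE => /orP[/eqP -> //|].
by apply: IH => //; rewrite -E ?mem_next //; apply: Qn.
Qed.

Lemma odd_count_addb (p q : pred T) s :
  odd (count p s) (+) odd (count q s) = odd (count (fun x => p x (+) q x) s).
Proof.
elim: s => //= x s; rewrite !oddD => <-.
by rewrite addbACA; case: (p x); case: (q x).
Qed.
End Steps.

(** The sum telescopes modulo 2. On a closed walk it vanishes, so a cycle crosses the border of any
    vertex set [g] an even number of times. *)
Lemma odd_count_potential (T : choiceType) (g : pred T) x s :
  odd (count (fun p => g p.1 (+) g p.2) (steps x s)) = g x (+) g (last x s).
Proof.
elim: s x => [|y s IH] x /=; first by rewrite addbb.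
by rewrite oddD IH; case: (g x); case: (g y); case: (g (last _ _)).
Qed.

Lemma odd_count_cycle (T : choiceType) (g : pred T) c :
  odd (count (fun p => g p.1 (+) g p.2) (csteps c)) = false.
Proof. by case: c => //= x s; rewrite odd_count_potential last_rcons addbb. Qed.

(** * Simple cycles of the grid graph *)

Definition edges (c : seq vertex) : {fset edge} :=
  [fset [fset v; next c v]%fset | v in c]%fset.

Lemma edgesE c u v : uniq c -> ([fset u; v]%fset \in edges c) = cedge c u v.
Proof.
move=> Uc; apply/imfsetP/idP => /=.
  move=> [z zc /eqP]; rewrite fset2_eq /cedge !mem_csteps //.
  by case/orP => /eqP[-> ->]; rewrite zc eqxx ?orbT.
rewrite /cedge !mem_csteps //; case/orP => /andP[zc /eqP ->].
  by exists u.
by exists v => //; rewrite fsetUC.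
Qed.

Definition simple_cycle (c : seq vertex) := [/\ (2 < size c)%N, cycle adj c & uniq c].

Lemma is_cycleP E : is_cycle E <-> exists2 c, simple_cycle c & E = edges c.
Proof.
split=> [[c [sc uc ->]]|[c [sc cc uc] ->]].
  by exists c => //; case/andP: uc.
by exists c; split => //; apply/andP.
Qed.

Lemma adj_sym u v : adj u v = adj v u.
Proof. by rewrite /adj; congr (_ == _); lia. Qed.

Variant adj_spec (u : vertex) : vertex -> Prop :=
  | AdjE : adj_spec u (u.1 + 1, u.2)
  | AdjW : adj_spec u (u.1 - 1, u.2)
  | AdjN : adj_spec u (u.1, u.2 + 1)
  | AdjS : adj_spec u (u.1, u.2 - 1).

Lemma adjP u v : adj u v -> adj_spec u v.
Proof.
case: u v => [u1 u2] [v1 v2]; rewrite /adj /= => A.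
have : (v1 = u1 + 1 /\ v2 = u2) \/ (v1 = u1 - 1 /\ v2 = u2) \/
  (v1 = u1 /\ v2 = u2 + 1) \/ (v1 = u1 /\ v2 = u2 - 1) by lia.
by case=> [|[|[|]]] -[-> ->]; constructor.
Qed.

Lemma adj_neq u v : adj u v -> u != v.
Proof. by rewrite /adj => A; apply/eqP => E; rewrite E in A; lia. Qed.

Lemma cedge_adj c u v : simple_cycle c -> cedge c u v -> adj u v.
Proof.
case=> _; rewrite cycle_csteps => /allP H _ /orP[/H //|/H /=].
by rewrite adj_sym.
Qed.

(** Otherwise [u] and its successor would form a set closed under [next c], hence all of [c],
    against its length. *)
Lemma next_neq_prev c u : simple_cycle c -> u \in c -> next c u != prev c u.
Proof.
case=> sc _ Uc uc; apply/eqP => E.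
have E2 : next c (next c u) = u by rewrite E next_prev.
have H : forall v, v \in c -> v \in [:: u; next c u].
  apply: (cycle_ind Uc _ uc); last by rewrite inE eqxx.
  by move=> v vc; rewrite !inE => /orP[] /eqP ->; rewrite ?eqxx ?orbT // E2 eqxx.
have := uniq_leq_size Uc H; by rewrite leqNgt sc.
Qed.

Lemma csteps_asym c u v : simple_cycle c -> (u, v) \in csteps c -> (v, u) \notin csteps c.
Proof.
move=> cc; have [_ _ Uc] := cc; rewrite !mem_csteps // => /andP[uc /eqP ->].
rewrite mem_next uc /=; apply/negP => /eqP E.
by have := next_neq_prev cc uc; rewrite {2}E prev_next // eqxx.
Qed.

(* The step [p] crosses the horizontal ray going left from the centre of [s]; the
   vertex coordinates are shifted by 1/2, see [vertex]. *)
Definition cross (s : square) (p : vertex * vertex) : bool :=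
  [&& p.1.1 == p.2.1, p.1.1 < s.1 &
    ((p.1.2 == s.2 - 1) && (p.2.2 == s.2)) || ((p.1.2 == s.2) && (p.2.2 == s.2 - 1))].

Definition inside (c : seq vertex) (s : square) : bool := odd (count (cross s) (csteps c)).

(** A simple cycle traverses an edge at most once and in one direction only, so the count is 0 or
    1. *)
Lemma odd_count_pair c u v : simple_cycle c ->
  odd (count (fun p => (p == (u, v)) || (p == (v, u))) (csteps c)) = cedge c u v.
Proof.
move=> cc; have [_ _ Uc] := cc; have Us := csteps_uniq Uc.
have [Euv|nuv] := eqVneq u v.
  rewrite -Euv /cedge orbb (@eq_count _ _ (pred1 (u, u))); last by move=> p /=; rewrite orbb.
  by rewrite count_uniq_mem //; case: (_ \in _).
have /= := count_predUI (pred1 (u, v)) (pred1 (v, u)) (csteps c).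
rewrite (@eq_count _ (predI _ _) pred0); last first.
  by move=> p /=; apply/negP => /andP[/eqP -> /eqP[E _]]; rewrite E eqxx in nuv.
rewrite count_pred0 addn0 !count_uniq_mem // => ->; rewrite /cedge.
case E : ((u, v) \in _); last by case: (_ \in _).
by rewrite (negbTE (csteps_asym cc E)).
Qed.

(** The ray of the right square extends that of the left one across their common side. *)
Lemma inside_h c (a b : int) : simple_cycle c ->
  inside c (a + 1, b) (+) inside c (a, b) = cedge c (a, b - 1) (a, b).
Proof.
move=> cc; rewrite /inside odd_count_addb -odd_count_pair //.
congr odd; apply: eq_count => -[[u1 u2] [v1 v2]].
by rewrite /cross /= !xpair_eqE; lia.
Qed.

Lemma inside_v c (a b : int) : simple_cycle c ->
  inside c (a, b + 1) (+) inside c (a, b) = cedge c (a - 1, b) (a, b).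
Proof.
move=> cc; rewrite /inside odd_count_addb -odd_count_pair //.
apply/eqP; rewrite -negb_add odd_count_addb; apply/negP.
(* [g] is the row of vertices between the two rays, up to the common side of the squares. An edge
   leaving it either crosses one of the rays or is that side. *)
pose g (u : vertex) := (u.2 == b) && (u.1 < a).
suff E : {in csteps c, forall p, cross (a, b + 1) p (+) cross (a, b) p (+)
    ((p == (a - 1, b, (a, b))) || (p == (a, b, (a - 1, b)))) = g p.1 (+) g p.2}.
  by rewrite (eq_in_count E) odd_count_cycle.
have [_ + _] := cc; rewrite cycle_csteps => /allP A -[[u1 u2] v] /A/= /adjP[];
  rewrite /g /cross /= !xpair_eqE.
- by have [?|?] := eqVneq u2 b; have [?|?] := eqVneq u1 (a - 1); lia.
- by have [?|?] := eqVneq u2 b; have [?|?] := eqVneq u1 a; lia.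
- have -> : (u2 == b + 1 - 1) = (u2 == b) by lia.
  have -> : (u2 + 1 == b + 1) = (u2 == b) by lia.
  have -> : (u2 == b + 1) && (u2 + 1 == b + 1 - 1) = false by lia.
  have -> : (u2 == b - 1) = (u2 + 1 == b) by lia.
  have -> : (u2 == b) && (u2 + 1 == b - 1) = false by lia.
  have -> : [&& (u1 == a - 1) && (u2 == b), u1 == a & u2 + 1 == b] = false by lia.
  have -> : [&& (u1 == a) && (u2 == b), u1 == a - 1 & u2 + 1 == b] = false by lia.
  by rewrite eqxx !andbb !orbF addbF /=; congr addb; rewrite andbC.
- have -> : (u2 == b + 1 - 1) && (u2 - 1 == b + 1) = false by lia.
  have -> : (u2 == b + 1) = (u2 - 1 == b) by lia.
  have -> : (u2 - 1 == b + 1 - 1) = (u2 - 1 == b) by lia.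
  have -> : (u2 == b - 1) && (u2 - 1 == b) = false by lia.
  have -> : (u2 - 1 == b - 1) = (u2 == b) by lia.
  have -> : [&& (u1 == a - 1) && (u2 == b), u1 == a & u2 - 1 == b] = false by lia.
  have -> : [&& (u1 == a) && (u2 == b), u1 == a - 1 & u2 - 1 == b] = false by lia.
  by rewrite eqxx !andbb /= addbF addbC; congr addb; rewrite andbC.
Qed.

(** * Discrete Jordan curve theorem *)

(* The square on the left of the edge traversed from [u] to [v]. *)
Definition left_square (u v : vertex) : square :=
  (if (u.1 < v.1) || (v.2 < u.2) then u.1 + 1 else u.1,
   if (u.1 < v.1) || (u.2 < v.2) then u.2 + 1 else u.2).

Ltac left_square_simp := rewrite /left_square /=; congr pair; do ?case: ifP; lia.

Lemma corner_left_square u v : adj u v ->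
  [/\ corner (left_square u v) u, corner (left_square u v) v,
      corner (left_square v u) u & corner (left_square v u) v].
Proof.
by case/adjP; rewrite /corner /left_square !inE /=; split; apply/andP; split;
  case: ifP; lia.
Qed.

Lemma side_left_square s u v : adj u v -> corner s u -> corner s v ->
  s = left_square u v \/ s = left_square v u.
Proof.
case: s => s1 s2 /adjP[]; rewrite /corner !inE /= => A B.
- have [E|N] := eqVneq s2 u.2; [right|left]; left_square_simp.
- have [E|N] := eqVneq s2 u.2; [left|right]; left_square_simp.
- have [E|N] := eqVneq s1 u.1; [left|right]; left_square_simp.
- have [E|N] := eqVneq s1 u.1; [right|left]; left_square_simp.
Qed.

(** Merges [inside_h] and [inside_v], so that later arguments need not distinguish directions. *)
Lemma inside_left_square c u v : simple_cycle c -> adj u v ->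
  inside c (left_square u v) (+) inside c (left_square v u) = cedge c u v.
Proof.
move=> cc; case: u => u1 u2 /adjP[] /=.
- have -> : left_square (u1, u2) (u1 + 1, u2) = (u1 + 1, u2 + 1) by left_square_simp.
  have -> : left_square (u1 + 1, u2) (u1, u2) = (u1 + 1, u2) by left_square_simp.
  by rewrite inside_v // addrK.
- have -> : left_square (u1, u2) (u1 - 1, u2) = (u1, u2) by left_square_simp.
  have -> : left_square (u1 - 1, u2) (u1, u2) = (u1, u2 + 1) by left_square_simp.
  by rewrite addbC inside_v // cedge_sym.
- have -> : left_square (u1, u2) (u1, u2 + 1) = (u1, u2 + 1) by left_square_simp.
  have -> : left_square (u1, u2 + 1) (u1, u2) = (u1 + 1, u2 + 1) by left_square_simp.
  by rewrite addbC inside_h // addrK.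
- have -> : left_square (u1, u2) (u1, u2 - 1) = (u1 + 1, u2) by left_square_simp.
  have -> : left_square (u1, u2 - 1) (u1, u2) = (u1, u2) by left_square_simp.
  by rewrite inside_h // cedge_sym.
Qed.

(* [s] and [t] are equal or share an edge that is not in [c]. *)
Definition dstep c (s t : square) := exists u v : vertex,
  [/\ adj u v, ~~ cedge c u v, corner s u && corner s v & corner t u && corner t v].

Inductive link c (s : square) : square -> Prop :=
  | link_refl : link c s s
  | link_step t r : link c s t -> dstep c t r -> link c s r.

Lemma dstep_sym c s t : dstep c s t -> dstep c t s.
Proof. by case=> u [v [? ? ? ?]]; exists u, v. Qed.

Lemma link1 c s t : dstep c s t -> link c s t.
Proof. by move=> h; apply: link_step h; apply: link_refl. Qed.

Lemma link_trans c t s r : link c s t -> link c t r -> link c s r.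
Proof. by move=> h; elim=> // a b _ h1 h2; apply: link_step h2. Qed.

Lemma link_sym c s t : link c s t -> link c t s.
Proof.
elim=> [|a b _ h1 h2]; first exact: link_refl.
by apply: link_trans h1; apply/link1/dstep_sym.
Qed.

Lemma inside_dstep c s t : simple_cycle c -> dstep c s t -> inside c s = inside c t.
Proof.
move=> cc [u [v [A /negPf ncuv /andP[su sv] /andP[tu tv]]]].
have := inside_left_square cc A; rewrite ncuv => /eqP; rewrite eqbF_neg negb_add => /eqP E.
by case: (side_left_square A su sv) => ->; case: (side_left_square A tu tv) => ->; rewrite ?E.
Qed.

Lemma inside_link c s t : simple_cycle c -> link c s t -> inside c s = inside c t.
Proof. by move=> cc; elim=> // a b _ -> /inside_dstep->. Qed.

Lemma dstep_left_square c u v : adj u v -> ~~ cedge c u v ->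
  dstep c (left_square u v) (left_square v u).
Proof.
by move=> A n; exists u, v; case: (corner_left_square A) => -> -> -> ->.
Qed.

(* Rotate around [v] from the edge [vz] to the edge [vu]. *)
Lemma link_turn c u v z : adj v u -> adj v z -> u != z ->
  (forall y, adj v y -> y != u -> y != z -> ~~ cedge c v y) ->
  link c (left_square u v) (left_square v z).
Proof.
move=> Au Az nuz H.
have turn y : adj v y -> y != u -> y != z -> link c (left_square y v) (left_square v y).
  by move=> A n1 n2; apply/link_sym/link1/dstep_left_square/H.
case: v Au Az turn {H} => v1 v2 Au Az turn; set v := (v1, v2) in Au Az turn *.
pose E : vertex := (v1 + 1, v2); pose N : vertex := (v1, v2 + 1).
pose W : vertex := (v1 - 1, v2); pose S : vertex := (v1, v2 - 1).
have dir y : adj v y -> [\/ y = E, y = N, y = W | y = S] by case/adjP; constructor.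
(* Each of the four squares at [v] gets two names, so that [tE], [tN], [tW] and [tS] chain into
   counterclockwise quarter turns around [v]. *)
have EE : left_square E v = left_square v S by rewrite /E /S /v; left_square_simp.
have NN : left_square N v = left_square v E by rewrite /E /N /v; left_square_simp.
have WW : left_square W v = left_square v N by rewrite /W /N /v; left_square_simp.
have SS : left_square S v = left_square v W by rewrite /W /S /v; left_square_simp.
have tE : E != u -> E != z -> link c (left_square v S) (left_square v E).
  by rewrite -EE; apply: turn; rewrite /adj /=; clear; lia.
have tN : N != u -> N != z -> link c (left_square v E) (left_square v N).
  by rewrite -NN; apply: turn; rewrite /adj /=; clear; lia.
have tW : W != u -> W != z -> link c (left_square v N) (left_square v W).
  by rewrite -WW; apply: turn; rewrite /adj /=; clear; lia.
have tS : S != u -> S != z -> link c (left_square v W) (left_square v S).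
  by rewrite -SS; apply: turn; rewrite /adj /=; clear; lia.
have nEN : E != N by clear; rewrite xpair_eqE; lia.
have nEW : E != W by clear; rewrite xpair_eqE; lia.
have nES : E != S by clear; rewrite xpair_eqE; lia.
have nNW : N != W by clear; rewrite xpair_eqE; lia.
have nNS : N != S by clear; rewrite xpair_eqE; lia.
have nWS : W != S by clear; rewrite xpair_eqE; lia.
clearbody E N W S v; apply: link_sym.
(* At most two directions lie strictly between [z] and [u], so at most two quarter turns are
   needed. *)
case: (dir u Au) tE tN tW tS nuz => -> tE tN tW tS; rewrite ?EE ?NN ?WW ?SS;
case: (dir z Az) tE tN tW tS => -> tE tN tW tS; rewrite ?eqxx // => _;
  first [ exact: link_refl
  | solve [ apply: tE => //; by rewrite eq_sym ]
  | solve [ apply: tN => //; by rewrite eq_sym ]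
  | solve [ apply: tW => //; by rewrite eq_sym ]
  | solve [ apply: tS => //; by rewrite eq_sym ]
  | solve [ apply: link_trans (tE _ _) (tN _ _) => //; by rewrite eq_sym ]
  | solve [ apply: link_trans (tN _ _) (tW _ _) => //; by rewrite eq_sym ]
  | solve [ apply: link_trans (tW _ _) (tS _ _) => //; by rewrite eq_sym ]
  | solve [ apply: link_trans (tS _ _) (tE _ _) => //; by rewrite eq_sym ] ].
Qed.

(** Only two edges of [c] meet at [v], so turning from one to the other, on either side, crosses no
    edge of [c]. The second link is the turn on the cycle run backwards. *)
Lemma link_turn_cycle c v : simple_cycle c -> v \in c ->
  link c (left_square (prev c v) v) (left_square v (next c v)) /\
  link c (left_square (next c v) v) (left_square v (prev c v)).
Proof.
move=> cc vc; have [_ _ Uc] := cc; have npn := next_neq_prev cc vc.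
have An : adj v (next c v) by apply: (cedge_adj cc); rewrite cedgeE // eqxx.
have Ap : adj v (prev c v) by apply: (cedge_adj cc); rewrite cedgeE // eqxx orbT.
split; apply: link_turn => //; try by rewrite eq_sym.
  by move=> y _ n1 n2; rewrite cedgeE // negb_or n1 n2.
by move=> y _ n1 n2; rewrite cedgeE // negb_or n1 n2.
Qed.

(** The left squares of two successive edges are joined by turning at their common vertex. *)
Lemma link_left c x v : simple_cycle c -> x \in c -> v \in c ->
  link c (left_square x (next c x)) (left_square v (next c v)).
Proof.
move=> cc xc; have [_ _ Uc] := cc; move: v.
apply: (cycle_ind Uc _ xc); last exact: link_refl.
move=> v vc h; apply: link_trans h _.
have nvc : next c v \in c by rewrite mem_next.
by have [] := link_turn_cycle cc nvc; rewrite prev_next.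
Qed.

Lemma link_right c x v : simple_cycle c -> x \in c -> v \in c ->
  link c (left_square (next c x) x) (left_square (next c v) v).
Proof.
move=> cc xc; have [_ _ Uc] := cc; move: v.
apply: (cycle_ind Uc _ xc); last exact: link_refl.
move=> v vc h; apply: link_trans h (link_sym _).
have nvc : next c v \in c by rewrite mem_next.
by have [_] := link_turn_cycle cc nvc; rewrite prev_next.
Qed.

Lemma int_walk (P : int -> Prop) a b :
  (forall x, P x -> P (x + 1)) -> (forall x, P x -> P (x - 1)) -> P a -> P b.
Proof.
move=> up down; rewrite -[b](subrK a) addrC => Pa; case: (b - a) => n.
  by elim: n => [|n IH]; rewrite ?addr0 // -addn1 PoszD addrA; apply: up.
elim: n => [|n IH]; rewrite NegzE; first exact: down.
  have -> : a - n.+2%:Z = a + Negz n - 1 by rewrite NegzE; lia.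
  exact: down.
Qed.

(** Induction form of the connectedness of the grid: move along the row of [s], then along the
    column of [t]. *)
Lemma square_walk (Q : square -> Prop) s t :
  (forall u v a b, adj u v -> corner a u && corner a v -> corner b u && corner b v ->
     Q a -> Q b) -> Q s -> Q t.
Proof.
case: s t => [s1 s2] [t1 t2] H Qs.
have R x y : Q (x, y) <-> Q (x + 1, y).
  by split; apply: (H (x, y - 1) (x, y)); rewrite /adj /corner /= ?inE; lia.
have U x y : Q (x, y) <-> Q (x, y + 1).
  by split; apply: (H (x - 1, y) (x, y)); rewrite /adj /corner /= ?inE; lia.
apply: (@int_walk (fun y => Q (t1, y)) s2) => [x /U //|x h|].
  by apply/U; rewrite subrK.
apply: (@int_walk (fun x => Q (x, s2)) s1) => [x /R //|x h|//].
by apply/R; rewrite subrK.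
Qed.

Lemma cedge_next (T : choiceType) (c : seq T) u v : uniq c -> cedge c u v ->
  exists2 y, y \in c & (u = y /\ v = next c y) \/ (v = y /\ u = next c y).
Proof.
move=> Uc; rewrite /cedge !mem_csteps // => /orP[]/andP[yc /eqP E].
  by exists u => //; left.
by exists v => //; right.
Qed.

(** Walk through the grid from the base square. A step across an edge of [c] ends on the left or
    right of that edge, and all left squares are linked, as are all right ones. *)
Lemma link_total c x s : simple_cycle c -> x \in c ->
  link c (left_square x (next c x)) s \/ link c (left_square (next c x) x) s.
Proof.
move=> cc xc; have [_ _ Uc] := cc.
pose Q s := link c (left_square x (next c x)) s \/ link c (left_square (next c x) x) s.
apply: (@square_walk Q (left_square x (next c x))); last by left; apply: link_refl.
move=> u v a b A ha /andP[hu hv] Qa; have [cuv|ncuv] := boolP (cedge c u v); last first.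
  have ab : dstep c a b by exists u, v; rewrite hu hv.
  by case: Qa => h; [left|right]; apply: link_step ab.
have [y yc E] := cedge_next Uc cuv.
have hl := link_left cc xc yc; have hr := link_right cc xc yc.
by case: (side_left_square A hu hv) => ->; case: E => -[-> ->]; [left|right|right|left].
Qed.

(** There are at most two classes of linked squares, those of the two sides of an edge of [c], and
    these sides have different parities. *)
Lemma jordan c s t : simple_cycle c -> inside c s = inside c t -> link c s t.
Proof.
move=> cc; have [+ _ Uc] := cc.
case Ec : c => [//|x c'] _; rewrite -Ec.
have xc : x \in c by rewrite Ec mem_head.
have := inside_left_square cc (cedge_adj cc (_ : cedge c x (next c x))).
rewrite cedgeE // eqxx => /(_ isT) /=.
case: (link_total s cc xc) => hs; case: (link_total t cc xc) => ht;
  rewrite -(inside_link cc hs) -(inside_link cc ht).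
- by move=> _ _; apply: link_trans (link_sym hs) ht.
- by move=> + E; rewrite E addbb.
- by move=> + E; rewrite E addbb.
- by move=> _ _; apply: link_trans (link_sym hs) ht.
Qed.

(** No edge of [c] ends at [v], so one can move freely between the four squares around it; three
    crossings connect them. *)
Lemma inside_vertex c v s t : simple_cycle c -> v \notin c -> corner s v -> corner t v ->
  inside c s = inside c t.
Proof.
move=> cc vc; have [_ _ Uc] := cc.
have nc y : ~~ cedge c v y.
  by apply/negP => /(cedge_mem Uc)/andP[h]; rewrite h in vc.
have K u a b : adj v u -> corner a v && corner a u -> corner b v && corner b u ->
    inside c a = inside c b.
  by move=> A ha hb; apply: (inside_dstep cc); exists v, u; rewrite A nc ha.
case: v {vc nc} K => v1 v2 K.
have KE := K (v1 + 1, v2) (v1 + 1, v2) (v1 + 1, v2 + 1).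
have KW := K (v1 - 1, v2) (v1, v2) (v1, v2 + 1).
have KN := K (v1, v2 + 1) (v1, v2 + 1) (v1 + 1, v2 + 1).
rewrite /corner /adj !inE /= in KE KW KN.
case: s t => [s1 s2] [t1 t2]; rewrite /corner !inE /= => hs ht.
have {}KE : inside c (v1 + 1, v2) = inside c (v1 + 1, v2 + 1) by apply: KE; clear; lia.
have {}KW : inside c (v1, v2) = inside c (v1, v2 + 1) by apply: KW; clear; lia.
have {}KN : inside c (v1, v2 + 1) = inside c (v1 + 1, v2 + 1) by apply: KN; clear; lia.
have H x y : ((v1 == x - 1) || (v1 == x)) && ((v2 == y - 1) || (v2 == y)) ->
    inside c (x, y) = inside c (v1, v2).
  move=> h.
  have {h} [[-> ->]|[-> ->]|[-> ->]|[-> ->]] // : [\/ x = v1 /\ y = v2, x = v1 /\ y = v2 + 1,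
      x = v1 + 1 /\ y = v2 | x = v1 + 1 /\ y = v2 + 1].
    case/andP: h => /orP[]/eqP -> /orP[]/eqP ->; rewrite ?subrK.
    - by constructor 4.
    - by constructor 3.
    - by constructor 2.
    - by constructor 1.
  - by rewrite KE KW KN.
  - by rewrite KW KN.
by rewrite !H.
Qed.

(** * Ears and maximal cycles *)

Lemma seq_bound (s : seq vertex) :
  exists N : nat, forall u : vertex, u \in s -> `|u.1| <= N%:Z /\ `|u.2| <= N%:Z.
Proof.
elim: s => [|w s [N H]]; first by exists 0.
exists (N + `|w.1| + `|w.2|)%N => u; rewrite inE => /orP[/eqP ->|/H [h1 h2]].
  by clear; split; lia.
by move: h1 h2; clear; split; lia.
Qed.

Lemma inside_bound c (N : nat) s : simple_cycle c ->
  (forall u : vertex, u \in c -> `|u.1| <= N%:Z /\ `|u.2| <= N%:Z) ->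
  inside c s -> `|s.1| <= N.+1%:Z /\ `|s.2| <= N.+1%:Z.
Proof.
move=> cc H ins; have [_ + Uc] := cc; rewrite cycle_csteps => /allP A.
(* An odd number of crossings is nonzero, and one crossed edge already bounds the row of [s] and
   keeps [s] from being too far left. *)
have : has (cross s) (csteps c).
  by rewrite has_count; move: ins; rewrite /inside; case: (count _ _).
case/hasP => -[u v]; rewrite mem_csteps // => /andP[uc /eqP Ev] K.
have vc : v \in c by rewrite Ev mem_next.
have B1 : - N%:Z < s.1 /\ `|s.2| <= N.+1%:Z.
  have [] := H _ uc; have [] := H _ vc; move: K; rewrite /cross /=; clear; lia.
case: B1 => B1 B2; split => //; rewrite leNgt; apply/negP => B3.
have {}B3 : N.+1%:Z < s.1 by move: B1 B3; clear; lia.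
move: ins; rewrite /inside.
(* If [s] is to the right of [c], the ray meets every vertical edge of its row:
   an even number. *)
pose g (w : vertex) := s.2 <= w.2.
suff E : {in csteps c, forall p, cross s p = g p.1 (+) g p.2}.
  by rewrite (eq_in_count E) odd_count_cycle.
move=> [a b] st; move: (st); rewrite mem_csteps // => /andP[ac _].
have {}B3 : (a : vertex).1 < s.1 by have [] := H _ ac; move: B3; clear; lia.
move/A: st => /= /adjP[]; rewrite /cross /g /= ?eqxx ?B3; move: (a.1) (a.2) (s.2) => x y z;
 clear.
- by rewrite addbb; apply/negP; lia.
- by rewrite addbb; apply/negP; lia.
- have [->|n] := eqVneq y (z - 1); first lia.
  by have [h|h] := leP z y; lia.
- have [->|n] := eqVneq y z; first lia.
  by have [h|h] := leP z y; lia.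
Qed.

Lemma outside_far c : simple_cycle c ->
  exists N : nat, forall s : square, N%:Z < s.1 -> ~~ inside c s.
Proof.
move=> cc; have [N H] := seq_bound c; exists N.+1 => s Hs; apply/negP => ins.
by have [] := inside_bound cc H ins; move: Hs; clear; lia.
Qed.

(** A square outside [c] is linked, without crossing [c], to a square [t] far to the right of both
    cycles. The path stays outside [c], where by hypothesis [d] has no edge to cross, so the square
    is outside [d] too. *)
Lemma inside_sub c d : simple_cycle c -> simple_cycle d ->
  (forall u v s, cedge d u v -> ~~ cedge c u v -> corner s u -> corner s v -> inside c s) ->
  forall s, inside d s -> inside c s.
Proof.
move=> cc cd H s; apply: contraLR => ns.
have [N hN] := outside_far cc; have [M hM] := outside_far cd.
pose t : square := ((N + M).+1%:Z, 0).
have ct : inside c t = false by apply/negbTE/hN; rewrite /=; clear; lia.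
have dt : inside d t = false by apply/negbTE/hM; rewrite /=; clear; lia.
have L : link c s t by apply: jordan => //; rewrite ct (negbTE ns).
suff -> : inside d s = inside d t by rewrite dt.
clear ct dt; elim: L => // a b L -> [u [v [A nc /andP[au av] bb]]].
have nd : ~~ cedge d u v.
  apply: contra ns => dv; rewrite (inside_link cc L); exact: H au av.
by apply: inside_dstep => //; exists u, v; rewrite au av bb.
Qed.

Lemma sides_same c u v s t : simple_cycle c -> adj u v -> ~~ cedge c u v ->
  corner s u -> corner s v -> corner t u -> corner t v -> inside c s = inside c t.
Proof.
by move=> cc A n h1 h2 h3 h4; apply: inside_dstep => //; exists u, v; rewrite h1 h2 h3.
Qed.

(** Successive edges of the ear meet at a vertex off [c], around which the parity is constant; hence
    one value [w] serves the whole ear. *)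
Lemma ear_sides c x p y : simple_cycle c ->
  {in steps x (rcons p y), forall e, adj e.1 e.2 && ~~ cedge c e.1 e.2} ->
  {in p, forall z, z \notin c} ->
  exists w, forall u v s, (u, v) \in steps x (rcons p y) ->
    corner s u -> corner s v -> inside c s = w.
Proof.
move=> cc; elim: p x => [|z p IH] x H np.
  have /andP[A n] : adj x y && ~~ cedge c x y by apply: (H (x, y)); rewrite /= inE.
  exists (inside c (left_square x y)) => u v s; rewrite inE => /eqP[-> ->] h1 h2.
  by have [? ? _ _] := corner_left_square A; apply: (sides_same cc A).
have [w Hw] : exists w, forall u v s, (u, v) \in steps z (rcons p y) ->
    corner s u -> corner s v -> inside c s = w.
  apply: IH => [e he|a ha]; last by apply: np; rewrite inE ha orbT.
  by apply: H; rewrite /= inE he orbT.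
exists w => u v s; rewrite /= inE => /orP[/eqP[_ ->] _ sz|]; last exact: Hw.
(* The edge of the ear that leaves [z]; it ends at [y] when [z] is the last inner vertex. *)
have zh : (z, head y p) \in steps z (rcons p y) by case: (p) => [|? ?]; rewrite /= inE eqxx.
have /andP[A _] : adj z (head y p) && ~~ cedge c z (head y p).
  by apply: (H (z, head y p)); rewrite /= inE zh orbT.
have [h1 h2 _ _] := corner_left_square A.
rewrite -(Hw _ _ _ zh h1 h2); apply: (inside_vertex cc) sz h1.
by apply: np; rewrite mem_head.
Qed.

Lemma mem_steps_rev (T : choiceType) (x y : T) p u v :
  ((u, v) \in steps y (rcons (rev p) x)) = ((v, u) \in steps x (rcons p y)).
Proof.
rewrite (perm_mem (perm_steps_rev x p y)); apply/mapP/idP => [[[a b] h [-> ->]] //|h].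
by exists (v, u).
Qed.

Lemma count_cross_rev s x p y :
  count (cross s) (steps y (rcons (rev p) x)) = count (cross s) (steps x (rcons p y)).
Proof.
rewrite (permP (perm_steps_rev x p y)) count_map; apply: eq_count => -[u v].
rewrite /cross /= eq_sym; have [->|_] //= := eqVneq v.1 u.1.
by rewrite orbC; congr andb; rewrite andbC [X in _ || X]andbC.
Qed.

Lemma perm_csteps_rot (T : choiceType) (c : seq T) n :
  uniq c -> perm_eq (csteps (rot n c)) (csteps c).
Proof.
move=> Uc; rewrite !csteps_next ?rot_uniq //.
rewrite (eq_map (g := fun v => (v, next c v))); last by move=> v; rewrite next_rot.
by apply: perm_map; rewrite perm_rot.
Qed.

Lemma cedge_perm (T : choiceType) (c d : seq T) :
  perm_eq (csteps c) (csteps d) -> cedge c =2 cedge d.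
Proof. by move=> /perm_mem E u v; rewrite /cedge !E. Qed.

(* The arc of [d] containing [ab], cut at the first points of [P] on both sides. *)
Lemma exists_arc (T : choiceType) (d : seq T) (P : pred T) a b x0 y0 : uniq d ->
  cedge d a b -> x0 != y0 -> x0 \in d -> y0 \in d -> P x0 -> P y0 ->
  exists x p y, [/\ [/\ x != y, P x & P y], {in p, forall z, ~~ P z}, uniq p,
    {subset steps x (rcons p y) <= csteps d} &
    ((a, b) \in steps x (rcons p y)) || ((b, a) \in steps x (rcons p y))].
Proof.
move=> Ud; wlog ab : a b / (a, b) \in csteps d => [W|_].
  rewrite /cedge => /orP[] h nxy xd yd Px Py.
    by apply: (W a b) => //; rewrite /cedge h.
  have hc : cedge d b a by rewrite /cedge h.
  have [x [p [y [h1 h2 h3 h4 h5]]]] := W b a h hc nxy xd yd Px Py.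
  by exists x, p, y; split => //; rewrite orbC.
move=> nxy x0d y0d Px Py.
have bd : b \in d by move: ab; rewrite mem_csteps // => /andP[? /eqP ->]; rewrite mem_next.
(* Rotated to start at [b], the cycle ends at [a]. Reading forward from [b] finds [y], reading
   backward from [a] finds [x]. *)
case: (rot_to bd) => i s Ed.
have Us : uniq (b :: s) by rewrite -Ed rot_uniq.
have cs := perm_csteps_rot i Ud; rewrite Ed in cs.
have la : last b s = a.
  have : (last b s, b) \in csteps d.
    by rewrite -(perm_mem cs) /= steps_rcons mem_rcons inE eqxx.
  move: ab; rewrite !mem_csteps // => /andP[ad /eqP E1] /andP[ld /eqP E2].
  by rewrite -(prev_next Ud (last b s)) -E2 E1 prev_next.
have sub : {subset steps a (b :: s) <= csteps d}.
  move=> e; rewrite -(perm_mem cs) /= steps_rcons mem_rcons la inE => /orP[/eqP ->|h].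
    by rewrite eqxx.
  by rewrite h orbT.
have hP : has P (b :: s) by apply/hasP; exists x0; rewrite // -Ed mem_rot.
have x0s : x0 \in b :: s by rewrite -Ed mem_rot.
have y0s : y0 \in b :: s by rewrite -Ed mem_rot.
have lab : last a (b :: s) = a by [].
have hb : head b (b :: s) = b by [].
move: (b :: s) Us sub hP x0s y0s lab hb => d' Us sub hP x0s y0s lab hb.
case: (split_find hP) Us sub x0s y0s lab hb => y s1 r Py1 nP1 Us sub x0s y0s lab hb.
(* One of the distinct points [x0] and [y0] is not [y], and it lies beyond [y] since [s1] avoids
   [P]; so the backward search stops before [y], and [x] differs from [y]. *)
have hPr : has P (rev r).
  have K z : z \in rcons s1 y ++ r -> P z -> z != y -> has P (rev r).
    rewrite mem_cat mem_rcons inE => /orP[/orP[->//|zs]|zr] Pz nz.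
      by move/hasPn: nP1 => /(_ _ zs); rewrite Pz.
    by apply/hasP; exists z; rewrite ?mem_rev.
  have [E|n] := eqVneq x0 y; last exact: (K x0).
  by apply: (K y0); rewrite // -E eq_sym.
move: Us sub lab hb; rewrite -[r]revK.
case: (split_find hPr) => x t1 t2 Px1 nPt Us sub lab hb.
rewrite rev_cat rev_rcons in Us sub lab.
have l2 : last x (rev t1) = a by rewrite -lab !last_cat.
have Us1 : uniq [:: x, y & (rev t1 ++ s1) ++ rev t2].
  rewrite -(@perm_uniq _ (rcons s1 y ++ rev t2 ++ x :: rev t1)) //.
  by apply/permP => Q; rewrite -cats1 /= !count_cat /=; clear; lia.
(* The arc runs from [x] along [rev t1] up to [a], then from [b] along [s1] to [y]. *)
exists x, (rev t1 ++ s1), y; split; first split => //.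
- by move: Us1; rewrite /= inE; case: (x == y).
- move=> z; rewrite mem_cat mem_rev => /orP[] zs; first by move/hasPn: nPt => /(_ z zs).
  by move/hasPn: nP1 => /(_ z zs).
- by move: Us1; rewrite /= => /and3P[_ _]; rewrite cat_uniq => /and3P[].
- move=> e; rewrite rcons_cat steps_cat l2 mem_cat => h; apply: sub.
  by rewrite !steps_cat !mem_cat /= inE; case/orP: h => ->; rewrite ?orbT.
- rewrite rcons_cat steps_cat l2 !mem_cat; apply/orP; left; apply/orP; right.
  by case: (s1) hb => [|h s1'] /= ->; rewrite inE eqxx.
Qed.

Lemma csteps_split (T : choiceType) (x y : T) A B :
  csteps (x :: A ++ y :: B) = steps x (rcons A y) ++ steps y (rcons B x).
Proof. by rewrite /= rcons_cat rcons_cons -cat_rcons steps_cat last_rcons. Qed.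

Lemma steps_inner (T : choiceType) (x y z u v : T) p :
  (u, v) \in steps x (rcons (z :: p) y) -> (u \in z :: p) || (v \in z :: p).
Proof.
elim: p x z => [|w p IH] x z.
  by rewrite /= !inE => /orP[] /eqP[-> ->]; rewrite eqxx ?orbT.
rewrite /= inE => /orP[/eqP[_ ->]|/IH]; first by rewrite !inE eqxx ?orbT.
by rewrite !(in_cons z) => /orP[] ->; rewrite !orbT.
Qed.

Lemma exists_inside c : simple_cycle c -> exists s, inside c s.
Proof.
move=> cc; have [+ _ Uc] := cc; case Ec: c => [//|x c'] _; rewrite -Ec.
have xc : x \in c by rewrite Ec mem_head.
have cx : cedge c x (next c x) by rewrite cedgeE // eqxx.
have := inside_left_square cc (cedge_adj cc cx); rewrite cx.
have [h _|_ h] := boolP (inside c (left_square x (next c x))).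
  by exists (left_square x (next c x)).
by exists (left_square (next c x) x).
Qed.

(* An arc of [d] outside [c] cuts [c] into two arcs, each closing up with it to a
   cycle; [inside c] is the sum mod 2 of the insides of these two cycles. Both are
   constant on the inside of [c], so one of them contains it. *)
Lemma exists_ear c d (a b x0 y0 : vertex) : simple_cycle c -> simple_cycle d ->
  cedge d a b -> ~~ cedge c a b -> ~~ inside c (left_square a b) ->
  x0 != y0 -> x0 \in c -> y0 \in c -> x0 \in d -> y0 \in d ->
  exists c', [/\ simple_cycle c', forall u v, cedge c' u v -> cedge c u v \/ cedge d u v,
    forall s, inside c s -> inside c' s
    & exists2 s, (s = left_square a b \/ s = left_square b a) & ~~ inside c s /\ inside c' s].
Proof.
move=> cc cd dab ncab nin nxy x0c y0c x0d y0d.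
have [sc _ Uc] := cc; have [_ _ Ud] := cd.
have Aab := cedge_adj cd dab.
have [x [p [y [[nxy1 xc yc] np Up Ed Eab]]]] :=
  @exists_arc _ d (mem c) a b x0 y0 Ud dab nxy x0d y0d x0c y0c.
have {}np : {in p, forall z, z \notin c} by move=> z /np.
pose ear (u v : vertex) :=
  ((u, v) \in steps x (rcons p y)) || ((v, u) \in steps x (rcons p y)).
have ear_d u v : ear u v -> cedge d u v.
  by rewrite /ear /cedge => /orP[] /Ed ->; rewrite ?orbT.
have ear_adj u v : ear u v -> adj u v by move/ear_d; apply: cedge_adj.
(* If the ear has inner vertices, each of its edges has one of them as an end, and these are off
   [c]. Otherwise it is the single edge [ab]. *)
have ear_c u v : ear u v -> ~~ cedge c u v.
  move=> huv; apply/negP => cuv; have /andP[uc vc] := cedge_mem Uc cuv.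
  have E : p = [::].
    case Ep : p => [//|z p']; exfalso.
    have : (u \in p) || (v \in p).
      by move: huv; rewrite /ear Ep => /orP[] /steps_inner; rewrite 1?orbC.
    by case/orP => /np; rewrite ?uc ?vc.
  move: huv Eab ncab; rewrite /ear E /= !inE.
  case/orP => /eqP[Eu Ev]; rewrite -Eu -Ev => /orP[] /eqP[-> ->];
    by rewrite ?cuv // cedge_sym cuv.
have step_c : {in steps x (rcons p y), forall e, adj e.1 e.2 && ~~ cedge c e.1 e.2}.
  by move=> [u v] he /=; rewrite ear_adj ?ear_c // /ear he.
have [w Hw] := ear_sides cc step_c np.
have [cab cba cab' cba'] := corner_left_square Aab.
have Ew : w = false.
  apply/negbTE; case/orP: Eab => h; first by rewrite -(Hw _ _ _ h cab cba).
  by rewrite -(Hw _ _ _ h cba cab).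
have out u v s : ear u v -> corner s u -> corner s v -> ~~ inside c s.
  by rewrite /ear => /orP[] h su sv; rewrite (Hw _ _ _ h _ _) ?Ew.
(* Any cycle [c1] made of the ear and edges of [c] will do once it shares an inside square with [c].
   A path inside [c] crosses neither [c] nor the ear, so [c1] encloses all that [c] does; and the
   parity of [c1] changes across [ab], both of whose sides are outside [c]. *)
have side c1 : simple_cycle c1 -> (forall u v, cedge c1 u v -> cedge c u v \/ ear u v) ->
    (forall u v, ear u v -> cedge c1 u v) ->
    (exists s, inside c s && inside c1 s) ->
  exists c', [/\ simple_cycle c', forall u v, cedge c' u v -> cedge c u v \/ cedge d u v,
    forall s, inside c s -> inside c' s
    & exists2 s, (s = left_square a b \/ s = left_square b a) & ~~ inside c s /\ inside c' s].
  move=> cc1 c1c earc1 [s /andP[cs c1s]]; exists c1; split => //.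
  - by move=> u v /c1c[|/ear_d]; [left|right].
  - move=> t ct; have : link c s t by apply: jordan => //; rewrite cs ct.
    move=> {ct}; elim=> // r q L c1r [u [v [A nc /andP[ru rv] qq]]].
    rewrite -(@inside_dstep c1 r q) //; exists u, v; split; rewrite ?ru //.
    apply/negP => /c1c[|/out/(_ ru rv)]; first exact/negP.
    by rewrite -(inside_link cc L) cs.
  - have := inside_left_square cc1 Aab; rewrite (earc1 _ _ Eab).
    have [h _|_ h] := boolP (inside c1 (left_square a b)).
      by exists (left_square a b) => //; left.
    by exists (left_square b a); [right|split => //; apply: out cab' cba'].
case: (rot_to xc) => i s Es.
have Us : uniq (x :: s) by rewrite -Es rot_uniq.
have ys : y \in s.
  have : y \in x :: s by rewrite -Es mem_rot.
  by rewrite inE eq_sym (negbTE nxy1).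
have pc := perm_csteps_rot i Uc; rewrite Es in pc.
have ps : x :: s =i c by move=> z; rewrite -Es mem_rot.
case/splitPr: ys Us pc ps {Es} => A B Us pc ps.
have mA z : z \in A -> z \in c by move=> h; rewrite -ps !(inE, mem_cat) h orbT.
have mB z : z \in B -> z \in c by move=> h; rewrite -ps !(inE, mem_cat) h !orbT.
have uniqQ Q : {subset Q <= c} -> uniq [:: x, y & Q] -> uniq ([:: x, y & Q] ++ p).
  move=> Qc UQ; rewrite cat_uniq UQ Up andbT /=; apply/hasPn => z zp.
  apply: contra (np z zp); rewrite /= !inE => /orP[/eqP -> //|/orP[/eqP -> //|/Qc]].
  by [].
have [UA UB] : uniq [:: x, y & A] /\ uniq [:: x, y & B].
  have : uniq ([:: x, y & A] ++ B).
    rewrite -(@perm_uniq _ (x :: A ++ y :: B)) //.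
    by apply/permP => Q; rewrite /= !count_cat /=; clear; lia.
  rewrite cat_uniq => /and3P[UA /hasPn h UB]; split => //.
  have nx : x \notin B by apply/negP => /h; rewrite mem_head.
  have ny : y \notin B by apply/negP => /h; rewrite !inE eqxx orbT.
  by rewrite /= inE negb_or [x != y]nxy1 nx ny.
(* This bound, and [B0] likewise, gives the new cycle more than two vertices: with both arcs empty,
   the ear would be an edge of [c]. *)
have A0 : (0 < size A + size p)%N.
  rewrite lt0n addn_eq0; apply/negP => /andP[/nilP EA /nilP Ep].
  have : ~~ cedge c x y by apply: ear_c; rewrite /ear Ep /= inE eqxx.
  by rewrite -(cedge_perm pc) /cedge EA /= inE eqxx.
have B0 : (0 < size B + size p)%N.
  rewrite lt0n addn_eq0; apply/negP => /andP[/nilP EB /nilP Ep].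
  have : ~~ cedge c x y by apply: ear_c; rewrite /ear Ep /= inE eqxx.
  by rewrite -(cedge_perm pc) /cedge csteps_split !mem_cat EB /= !inE eqxx !orbT.
have cA u v : (u, v) \in steps x (rcons A y) -> cedge c u v.
  by move=> h; rewrite -(cedge_perm pc) /cedge csteps_split !mem_cat h.
have cB u v : (u, v) \in steps y (rcons B x) -> cedge c u v.
  by move=> h; rewrite -(cedge_perm pc) /cedge csteps_split !mem_cat h orbT.
(* [A] and [B] are the two arcs of [c] between [x] and [y]; the first closes up with the reversed
   ear, the second with the ear. *)
pose c1 := x :: A ++ y :: rev p; pose c2 := x :: p ++ y :: B.
have c1E u v : cedge c1 u v -> cedge c u v \/ ear u v.
  rewrite /cedge !csteps_split !mem_cat !mem_steps_rev.
  move=> /orP[] /orP[h|h]; first by left; apply: cA.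
  - by right; rewrite /ear h orbT.
  - by left; move/cA: h; rewrite /cedge orbC.
  - by right; rewrite /ear h.
have c2E u v : cedge c2 u v -> cedge c u v \/ ear u v.
  rewrite /cedge !csteps_split !mem_cat.
  move=> /orP[] /orP[h|h].
  - by right; rewrite /ear h.
  - by left; apply: cB.
  - by right; rewrite /ear h orbT.
  - by left; move/cB: h; rewrite /cedge orbC.
have ear1 u v : ear u v -> cedge c1 u v.
  rewrite /cedge !csteps_split !mem_cat !mem_steps_rev.
  by case/orP => ->; rewrite !orbT.
have ear2 u v : ear u v -> cedge c2 u v.
  rewrite /cedge !csteps_split !mem_cat.
  by case/orP => ->; rewrite ?orbT.
have adjE c' : (forall u v, cedge c' u v -> cedge c u v \/ ear u v) -> cycle adj c'.
  move=> h; rewrite cycle_csteps; apply/allP => -[u v] huv /=.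
  have /h[|/ear_adj //] : cedge c' u v by rewrite /cedge huv.
  exact: cedge_adj.
have cc1 : simple_cycle c1.
  split; [|exact: adjE|].
    by rewrite /c1 /= size_cat /= size_rev addnS !ltnS.
  rewrite (@perm_uniq _ _ ([:: x, y & A] ++ p)); first exact: uniqQ.
  by apply/permP => Q; rewrite /= !count_cat /= count_rev; clear; lia.
have cc2 : simple_cycle c2.
  split; [|exact: adjE|].
    by rewrite /c2 /= size_cat /= addnS !ltnS addnC.
  rewrite (@perm_uniq _ _ ([:: x, y & B] ++ p)); first exact: uniqQ.
  by apply/permP => Q; rewrite /= !count_cat /=; clear; lia.
have [s0 hs0] := exists_inside cc.
(* The ear is counted in both cycles and cancels modulo 2. *)
have : inside c1 s0 (+) inside c2 s0 = inside c s0.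
  rewrite /inside -(permP pc) !csteps_split !count_cat count_cross_rev !oddD.
  by do 3!case: (odd _).
rewrite hs0; have [h1 _|_ h2] := boolP (inside c1 s0).
  by apply: (side c1) => //; exists s0; rewrite hs0.
by apply: (side c2) => //; exists s0; rewrite hs0.
Qed.

(** If [f] met [c] in at most one vertex, no edge of [f] would be on [c], so [f] would be drawn on
    [d] alone and equal it; but [d] has two vertices on [c]. *)
Lemma share_vertices f c d : simple_cycle f -> simple_cycle c -> simple_cycle d ->
  (forall u v, cedge f u v -> cedge c u v \/ cedge d u v) ->
  (exists u v : vertex, [/\ u != v, u \in c, v \in c, u \in d & v \in d]) ->
  exists u v : vertex, [/\ u != v, u \in f, v \in f, u \in c & v \in c].
Proof.
move=> cf cc cd fcd [x [y [nxy xc yc xd yd]]]; apply: contrapT => H.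
have [sf _ Uf] := cf; have [_ _ Uc] := cc; have [_ _ Ud] := cd.
have fd u v : cedge f u v -> cedge d u v.
  move=> fuv; case: (fcd _ _ fuv) => // cuv; exfalso; apply: H; exists u, v.
  have /andP[-> ->] := cedge_mem Uf fuv; have /andP[-> ->] := cedge_mem Uc cuv.
  by split => //; apply: adj_neq; apply: cedge_adj fuv.
have [v0 v0f] : exists v0, v0 \in f.
  by case: (f) sf => // v0 f' _; exists v0; rewrite mem_head.
have v0d : v0 \in d.
  have /fd/(cedge_mem Ud)/andP[//] : cedge f v0 (next f v0) by rewrite cedgeE // eqxx.
(* At a vertex of [f], its two distinct edges are the only two of [d], so the next vertex of [d] is
   again on [f]. *)
have df : forall v, v \in d -> v \in f.
  apply: (cycle_ind Ud _ v0d v0f) => v vd vf.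
  have n1 := next_neq_prev cf vf.
  have /fd : cedge f v (next f v) by rewrite cedgeE // eqxx.
  have /fd : cedge f v (prev f v) by rewrite cedgeE // eqxx orbT.
  rewrite !cedgeE // => /orP[/eqP E1|/eqP E1]; first by rewrite -E1 mem_prev.
  move=> /orP[/eqP E2|/eqP E2]; first by rewrite -E2 mem_next.
  by rewrite E1 E2 eqxx in n1.
by apply: H; exists x, y; split => //; apply: df.
Qed.

Lemma count_lt (T : eqType) (p q : pred T) (s : seq T) x :
  (forall y, p y -> q y) -> x \in s -> ~~ p x -> q x -> (count p s < count q s)%N.
Proof.
move=> pq xs npx qx.
have -> : count q s = (count p s + count (predI q (predC p)) s)%N.
  have := count_predUI p (predI q (predC p)) s.
  rewrite [count (predI p _) s](@eq_count _ _ pred0) ?count_pred0 ?addn0 => [<-|y /=].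
    by apply: eq_count => y /=; case E : (p y) => /=; rewrite ?andbT // pq.
  by case: (p y); rewrite ?andbF.
rewrite -[X in (X < _)%N]addn0 ltn_add2l -has_count; apply/hasP; exists x => //=.
by rewrite qx.
Qed.

(* Maximise the number of enclosed squares: [exists_ear] enlarges any cycle that
   leaves out an edge. *)
Lemma exists_max c d : simple_cycle c -> simple_cycle d ->
  (exists u v : vertex, [/\ u != v, u \in c, v \in c, u \in d & v \in d]) ->
  exists f, [/\ simple_cycle f, forall u v, cedge f u v -> cedge c u v \/ cedge d u v
    & forall u v s, cedge c u v \/ cedge d u v -> ~~ cedge f u v ->
        corner s u -> corner s v -> inside f s].
Proof.
move=> cc cd hcd; have [_ _ Uc] := cc; have [_ _ Ud] := cd.
have [N HN] := seq_bound (c ++ d).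
(* The squares with both coordinates between -(N+1) and N+1, which is 2N+3 values each. *)
pose box : seq square := [seq (Posz i - N.+1%:Z, Posz j - N.+1%:Z) |
  i <- iota 0 (N.+1 + N.+2), j <- iota 0 (N.+1 + N.+2)].
pose drawn f := forall u v, cedge f u v -> cedge c u v \/ cedge d u v.
have boxP f s : simple_cycle f -> drawn f -> inside f s -> s \in box.
  move=> cf fcd fs; have [_ _ Uf] := cf.
  have H (u : vertex) : u \in f -> `|u.1| <= N%:Z /\ `|u.2| <= N%:Z.
    move=> uf; apply: HN; rewrite mem_cat.
    have /fcd[] : cedge f u (next f u) by rewrite cedgeE // eqxx.
      by move=> /(cedge_mem Uc)/andP[->].
    by move=> /(cedge_mem Ud)/andP[->]; rewrite orbT.
  have [h1 h2] := inside_bound cf H fs.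
  apply/allpairsP; exists (absz (s.1 + N.+1%:Z), absz (s.2 + N.+1%:Z)).
  split; rewrite ?mem_iota; move: h1 h2; clear; case: s => s1 s2 /= h1 h2.
  - by lia.
  - by lia.
  - by congr pair; lia.
(* [k] strictly bounds the number of squares of [box] outside [f], which drops with each ear. *)
suff K k f : simple_cycle f -> drawn f -> (size box - count (inside f) box < k)%N ->
  exists f, [/\ simple_cycle f, drawn f
    & forall u v s, cedge c u v \/ cedge d u v -> ~~ cedge f u v ->
        corner s u -> corner s v -> inside f s].
  by apply: (K _ c) => // u v; left.
elim: k f => // k IH f cf fcd hk; apply: contrapT => H.
have [_ _ Uf] := cf.
apply: (H); exists f; split => // u v s cduv nf su sv; apply: contrapT => /negP ns.
have A : adj u v by case: cduv; apply: cedge_adj.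
have [h1 h2 _ _] := corner_left_square A.
have nl : ~~ inside f (left_square u v) by rewrite (sides_same cf A nf h1 h2 su sv).
have [f' [cf' f'cd sub [t _ [nt it]]]] : exists f', [/\ simple_cycle f', drawn f',
    forall s, inside f s -> inside f' s
    & exists2 s, (s = left_square u v \/ s = left_square v u) & ~~ inside f s /\ inside f' s].
  (* [exists_ear] is applied to [f] and whichever of [c] and [d] carries the edge; [share_vertices]
     supplies the two common vertices. *)
  case: cduv => e.
    have [x [y [nxy xf yf xc yc]]] := share_vertices cf cc cd fcd hcd.
    have [f' [h3 h4 h5 h6]] := exists_ear cf cc e nf nl nxy xf yf xc yc.
    by exists f'; split => // a b /h4[/fcd|]; [|left].
  have hdc : exists u v : vertex, [/\ u != v, u \in d, v \in d, u \in c & v \in c].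
    by case: hcd => x [y [? ? ? ? ?]]; exists x, y.
  have fdc a b : cedge f a b -> cedge d a b \/ cedge c a b by move=> /fcd[]; [right|left].
  have [x [y [nxy xf yf xc yc]]] := share_vertices cf cd cc fdc hdc.
  have [f' [h3 h4 h5 h6]] := exists_ear cf cd e nf nl nxy xf yf xc yc.
  by exists f'; split => // a b /h4[/fcd|]; [|right].
apply: H; apply: (IH f') => //.
have arith (m x y : nat) : (y <= m -> m - x < k.+1 -> x < y -> m - y < k)%N.
  by clear; lia.
apply: (arith _ _ _ (count_size _ _) hk).
exact: (count_lt sub (boxP _ _ cf' f'cd it) nt it).
Qed.

(** * Interior and exterior in the plane *)

Section Planar.
Variable R : realType.
Local Notation plane := (R^o * R^o)%type.

Definition center (s : square) : plane := (s.1%:~R, s.2%:~R).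

Definition in_square (s : square) (p : plane) : Prop :=
  `|p.1 - s.1%:~R : R| <= 2^-1 /\ `|p.2 - s.2%:~R : R| <= 2^-1.

(** On a grid line this picks the right or upper square; [inside_in_square] makes the choice
    harmless off the curve. *)
Definition square_of (p : plane) : square :=
  (Num.floor (p.1 + 2^-1 : R), Num.floor (p.2 + 2^-1 : R)).

Lemma segmentP (a b p : plane) : segment a b p <->
  exists t : R, [/\ 0 <= t <= 1, p.1 = (1 - t) * a.1 + t * b.1 :> R
                   & p.2 = (1 - t) * a.2 + t * b.2 :> R].
Proof.
split=> [[t ht <-]|[t [ht E1 E2]]]; first by exists t.
by exists t => //; case: p E1 E2 => p1 p2 /= -> ->.
Qed.

Lemma plane_segment_connected (a b : plane) : connected (segment a b).
Proof.
have -> : segment a b = (fun t : R => (1 - t) *: a + t *: b) @` `[0, 1]%classic.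
  by apply/seteqP; split => p [t]; rewrite /= ?in_itv /= => ht <-; exists t => //=; rewrite in_itv.
apply: connected_continuous_connected; first exact: segment_connected.
apply: continuous_subspaceT => t.
apply: cvgD; apply: cvgZl => //.
by apply: cvgB => //; apply: cvg_cst.
Qed.

Lemma half_int (a b : int) : `|a%:~R + 2^-1 - b%:~R : R| < 2^-1 -> False.
Proof.
rewrite ltr_norml => /andP[h1 h2].
have : (a < b)%R by rewrite -(ltr_int R); lra.
have : (b < a + 1)%R by rewrite -(ltr_int R) intrD; lra.
by lia.
Qed.

Lemma half_int_eq (a b : int) : a%:~R + 2^-1 <> b%:~R :> R.
Proof. by move=> E; apply: (@half_int a b); rewrite E subrr normr0; lra. Qed.

(** Used for the midpoint of an edge: it lies on only one unit edge of its grid line. *)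
Lemma int_mid (a b : int) : a%:~R + 2^-1 <= (b%:~R : R) + 1 <= a%:~R + 1 + 2^-1 -> a = b.
Proof.
move=> /andP[h1 h2].
have : (a < b + 1)%R by rewrite -(ltr_int R) intrD; lra.
have : (b < a + 1)%R by rewrite -(ltr_int R) intrD; lra.
by lia.
Qed.

(** Orienting each edge rightwards or upwards leaves two shapes instead of four. *)
Lemma traceP c (p : plane) : simple_cycle c ->
  trace (edges c) p <-> exists a b : int,
    [/\ cedge c (a, b) (a + 1, b), p.2 = b%:~R + 2^-1 :> R
       & a%:~R + 2^-1 <= (p.1 : R) <= a%:~R + 1 + 2^-1]
    \/ [/\ cedge c (a, b) (a, b + 1), p.1 = a%:~R + 2^-1 :> R
       & b%:~R + 2^-1 <= (p.2 : R) <= b%:~R + 1 + 2^-1].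
Proof.
move=> cc; have [_ _ Uc] := cc; split.
  move=> [u [v []]]; rewrite edgesE // => cuv /segmentP[t [/andP[t0 t1] E1 E2]].
  have := cedge_adj cc cuv; move: cuv E1 E2; case: u => u1 u2; rewrite /vpoint /= => cuv E1 E2 A.
  case: (adjP A) cuv E1 E2 => /= cuv; rewrite ?intrD ?intrB => E1 E2.
  - exists u1, u2; left; split => //;
      rewrite ?E1 ?E2; first lra.
    by apply/andP; split; lra.
  - exists (u1 - 1), u2; left; rewrite subrK cedge_sym intrB; split => //;
      rewrite ?E1 ?E2; first lra.
    by apply/andP; split; lra.
  - exists u1, u2; right; split => //;
      rewrite ?E1 ?E2; first lra.
    by apply/andP; split; lra.
  - exists u1, (u2 - 1); right; rewrite subrK cedge_sym intrB; split => //;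
      rewrite ?E1 ?E2; first lra.
    by apply/andP; split; lra.
move=> [a [b [] [cuv E /andP[h1 h2]]]].
  exists (a, b), (a + 1, b); split; first by rewrite edgesE.
  apply/segmentP; exists (p.1 - a%:~R - 2^-1); rewrite /vpoint /= intrD E; split; lra.
exists (a, b), (a, b + 1); split; first by rewrite edgesE.
apply/segmentP; exists (p.2 - b%:~R - 2^-1); rewrite /vpoint /= intrD E; split; lra.
Qed.

Lemma open_square_trace c s (p : plane) : simple_cycle c -> open_square s p -> ~ trace (edges c) p.
Proof.
move=> cc [h1 h2] /(traceP _ cc)[a [b [] [_ E _]]].
  by rewrite E in h2; apply: half_int h2.
by rewrite E in h1; apply: half_int h1.
Qed.

Lemma near_ints (x : R) (a b : int) : `|x - a%:~R| <= 2^-1 -> `|x - b%:~R| <= 2^-1 ->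
  [\/ a = b, b = a + 1 /\ x = a%:~R + 2^-1 | a = b + 1 /\ x = b%:~R + 2^-1].
Proof.
rewrite !ler_norml => /andP[h1 h2] /andP[h3 h4].
have : a <= b + 1 by rewrite -(ler_int R) intrD; lra.
have : b <= a + 1 by rewrite -(ler_int R) intrD; lra.
move=> k1 k2.
have : a = b \/ b = a + 1 \/ a = b + 1 by move: k1 k2; clear; lia.
case=> [->|[E|E]]; [constructor 1|constructor 2|constructor 3] => //; split => //.
  by move: h3 h4; rewrite E intrD; lra.
by move: h1 h2; rewrite E intrD; lra.
Qed.

(** Change one coordinate at a time: where the squares differ, [p] lies on their common side, which
    is then not an edge of [c]. *)
Lemma inside_in_square c s t (p : plane) : simple_cycle c -> ~ trace (edges c) p ->
  in_square s p -> in_square t p -> inside c s = inside c t.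
Proof.
case: s t p => [s1 s2] [t1 t2] [x y] cc np [/= hs1 hs2] [/= ht1 ht2].
have H a b : `|y - b%:~R| <= 2^-1 -> x = a%:~R + 2^-1 ->
    inside c (a + 1, b) = inside c (a, b).
  move=> hy ex; apply/eqP; rewrite -negb_add inside_h //; apply/negP => ca; apply: np.
  apply/(traceP _ cc); exists a, (b - 1); right; rewrite subrK; split => //=.
  by move: hy; rewrite ler_norml intrB => /andP[? ?]; apply/andP; split; lra.
have V a b : `|x - a%:~R| <= 2^-1 -> y = b%:~R + 2^-1 ->
    inside c (a, b + 1) = inside c (a, b).
  move=> hx ey; apply/eqP; rewrite -negb_add inside_v //; apply/negP => ca; apply: np.
  apply/(traceP _ cc); exists (a - 1), b; left; rewrite subrK; split => //=.
  by move: hx; rewrite ler_norml intrB => /andP[? ?]; apply/andP; split; lra.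
have -> : inside c (s1, s2) = inside c (t1, s2).
  by case: (near_ints hs1 ht1) => [->//|[-> E]|[-> E]]; rewrite H.
by case: (near_ints hs2 ht2) => [->//|[-> E]|[-> E]]; rewrite V.
Qed.

Lemma square_of_in (p : plane) : in_square (square_of p) p.
Proof.
split; rewrite /= ler_norml.
  have /andP[] := floor_itv (p.1 + 2^-1 : R); rewrite intrD; set f := _%:~R => h1 h2.
  by apply/andP; split; lra.
have /andP[] := floor_itv (p.2 + 2^-1 : R); rewrite intrD; set f := _%:~R => h1 h2.
by apply/andP; split; lra.
Qed.

Lemma square_of_open s (p : plane) : open_square s p -> square_of p = s.
Proof.
case: s => s1 s2 [/=]; rewrite !ltr_norml => /andP[h1 h2] /andP[h3 h4].
by congr pair; apply: floor_def; rewrite intrD; apply/andP; split; lra.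
Qed.

(** The segment from [p] to the centre lies in the open square, except possibly at [p] itself. *)
Lemma component_center c s (p : plane) : simple_cycle c -> ~ trace (edges c) p -> in_square s p ->
  connected_component (~` trace (edges c)) p (center s).
Proof.
move=> cc np [h1 h2].
exists (segment p (center s)); last first.
  by apply/segmentP; exists 1; split; lra.
split; last exact: plane_segment_connected.
  by apply/segmentP; exists 0; split; lra.
move=> q /segmentP[t [/andP[t0 t1] E1 E2]].
have [E|nt] := eqVneq t 0.
  suff -> : q = p by [].
  case: (q) (p) E1 E2 => q1 q2 [p1 p2] /= -> ->; rewrite E.
  by congr pair; rewrite subr0 mul1r mul0r addr0.
apply: (@open_square_trace c s q cc); rewrite /open_square /= E1 E2 /=.
have tp : 0 < t by rewrite lt_neqAle eq_sym nt.
have K (x y : R) : `|x - y| <= 2^-1 -> `|(1 - t) * x + t * y - y| < 2^-1.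
  move=> h; have -> : (1 - t) * x + t * y - y = (1 - t) * (x - y) by ring.
  rewrite normrM ger0_norm; last lra.
  by apply: (@le_lt_trans _ _ ((1 - t) * 2^-1)); [apply: ler_wpM2l => //; lra|lra].
by split; apply: K.
Qed.

(** Both centres are joined by segments to the midpoint [m] of the common edge, which is off the
    curve. *)
Lemma component_dstep c s t : simple_cycle c -> dstep c s t ->
  connected_component (~` trace (edges c)) (center s) (center t : plane).
Proof.
move=> cc [u [v [A nc]]].
wlog : u v A nc / (v = (u.1 + 1, u.2)) \/ (v = (u.1, u.2 + 1)) => [W|].
  case/adjP: A (A) nc => A nc.
  - by apply: (W u (u.1 + 1, u.2)) => //; left.
  - rewrite adj_sym in A; rewrite cedge_sym in nc.
    move=> /andP[h1 h2] /andP[h3 h4]; apply: (W _ _ A nc); rewrite ?h1 ?h2 ?h3 ?h4 //.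
    by left; rewrite /= subrK; case: (u).
  - by apply: (W u (u.1, u.2 + 1)) => //; right.
  - rewrite adj_sym in A; rewrite cedge_sym in nc.
    move=> /andP[h1 h2] /andP[h3 h4]; apply: (W _ _ A nc); rewrite ?h1 ?h2 ?h3 ?h4 //.
    by right; rewrite /= subrK; case: (u).
case: u A nc => a b A nc /= hv hs ht.
suff [m [nm ms mt]] : exists m : plane,
    [/\ ~ trace (edges c) m, in_square s m & in_square t m].
  apply: connected_component_trans (component_center cc nm mt).
  by apply: connected_component_sym; apply: component_center.
have I (x y : int) : (x == y - 1) || (x == y) ->
    `|(x%:~R : R) + 2^-1 - y%:~R| <= 2^-1.
  by case/orP => /eqP ->; rewrite ?intrB ler_norml; apply/andP; split; lra.
case: hv hs ht nc A => ->; rewrite /corner !inE /= => hs ht nc _.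
- have h1 : s.1 = a + 1 by move: hs; clear; lia.
  have h2 : t.1 = a + 1 by move: ht; clear; lia.
  exists (a%:~R + 1, b%:~R + 2^-1); split.
  + move=> /(traceP _ cc)[a' [b' []]] [ca /=].
      move=> /addIr/(intr_inj (R := R)) E /int_mid E'.
      by rewrite E -E' ca in nc.
    by move=> h _; apply: (@half_int_eq a' (a + 1)); rewrite intrD.
  + split; rewrite /= ?h1 ?intrD ?subrr ?normr0; first lra.
    by apply: I; move: hs; clear; lia.
  + split; rewrite /= ?h2 ?intrD ?subrr ?normr0; first lra.
    by apply: I; move: ht; clear; lia.
- have h1 : s.2 = b + 1 by move: hs; clear; lia.
  have h2 : t.2 = b + 1 by move: ht; clear; lia.
  exists (a%:~R + 2^-1, b%:~R + 1); split.
  + move=> /(traceP _ cc)[a' [b' []]] [ca /=].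
      by move=> h _; apply: (@half_int_eq b' (b + 1)); rewrite intrD.
    move=> /addIr/(intr_inj (R := R)) E /int_mid E'.
    by rewrite E -E' ca in nc.
  + split; rewrite /= ?h1 ?intrD ?subrr ?normr0; last lra.
    by apply: I; move: hs; clear; lia.
  + split; rewrite /= ?h2 ?intrD ?subrr ?normr0; last lra.
    by apply: I; move: ht; clear; lia.
Qed.

Lemma component_link c s t : simple_cycle c -> link c s t ->
  connected_component (~` trace (edges c)) (center s) (center t : plane).
Proof.
move=> cc; elim=> [|a b _ h1 h2].
  apply: connected_component_refl; apply: (@open_square_trace c s) => //.
  by split; rewrite /= subrr normr0; lra.
exact: connected_component_trans h1 (component_dstep cc h2).
Qed.

(** Rounding is locally constant unless [x] is halfway between two integers; then nearby points
    round to one of these, and both are at distance 1/2. *)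
Lemma near_floor (x : R) : exists2 e : R, 0 < e &
  forall y : R, `|x - y| < e -> `|x - (Num.floor (y + 2^-1))%:~R| <= 2^-1.
Proof.
have := floor_itv (x + 2^-1); set n := Num.floor _; rewrite intrD => /andP[h1 h2].
have [E|ne] := eqVneq (x + 2^-1) n%:~R.
  exists 1 => // y; rewrite ltr_norml => /andP[k1 k2].
  have := floor_itv (y + 2^-1); set m := Num.floor _; rewrite intrD => /andP[g1 g2].
  have : n < m + 2 by rewrite -(ltr_int R) intrD; lra.
  have : m < n + 1 by rewrite -(ltr_int R) intrD; lra.
  move=> l1 l2; have : m = n \/ m = n - 1 by move: l1 l2; clear; lia.
  by case=> ->; rewrite ?intrB ler_norml; apply/andP; split; lra.
have h3 : n%:~R < x + 2^-1 by rewrite lt_neqAle eq_sym ne.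
exists (Num.min (x + 2^-1 - n%:~R) (n%:~R + 1 - (x + 2^-1))).
  by rewrite lt_min; apply/andP; split; lra.
move=> y; rewrite lt_min !ltr_norml => /andP[/andP[k1 k2] /andP[k3 k4]].
have -> : Num.floor (y + 2^-1) = n.
  by apply: floor_def; rewrite intrD; apply/andP; split; lra.
by rewrite ler_norml; apply/andP; split; lra.
Qed.

Lemma near_square (p : plane) : \forall q \near p, in_square (square_of q) p.
Proof.
have [e1 e10 H1] := near_floor p.1; have [e2 e20 H2] := near_floor p.2.
apply/nbhs_ballP; exists (Num.min e1 e2); first by rewrite /= lt_min e10.
move=> q [q1 q2]; split.
  by apply: H1; apply: lt_le_trans q1 _; rewrite ge_min lexx.
by apply: H2; apply: lt_le_trans q2 _; rewrite ge_min lexx orbT.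
Qed.

(** Off the curve the parity is locally constant, by [near_square] and [inside_in_square]. Its level
    sets are thus open and closed in the connected set [K]. *)
Lemma component_inside c (p q : plane) : simple_cycle c ->
  connected_component (~` trace (edges c)) p q ->
  inside c (square_of p) = inside c (square_of q).
Proof.
move=> cc [K [Kp Ksub Kc] Kq].
have loc (x : plane) : K x -> \forall y \near x, inside c (square_of y) = inside c (square_of x).
  move=> Kx; apply: filterS (near_square x) => y hy.
  by apply: (inside_in_square cc _ hy (square_of_in x)); apply: Ksub.
pose W b := [set x : plane | inside c (square_of x) = b].
have open_W b : K `&` W b = K `&` (W b)^°.
  apply/seteqP; split=> x [Kx Wx]; split => //; last exact: interior_subset Wx.
  by apply: filterS (loc x Kx) => y; rewrite /W /= => ->.
set b := inside c (square_of p).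
have E : K `&` W b = K.
  apply: Kc; first by exists p.
    by exists (W b)^°; [exact: open_interior|exact: open_W].
  exists (~` (W (~~ b))^°); first exact/open_closedC/open_interior.
  apply/seteqP; split=> x [Kx Wx]; split => //.
    by move=> /interior_subset; rewrite /W /= Wx; case: (b).
  rewrite /W /=; apply: contrapT => n; apply: Wx.
  suff : (K `&` (W (~~ b))^°) x by case.
  by rewrite -open_W; split => //; rewrite /W /=; case: (inside _ _) (b) n => [] [].
have : (K `&` W b) q by rewrite E.
by case=> _ ->.
Qed.

Lemma bounded_inside c (p : plane) : simple_cycle c -> inside c (square_of p) ->
  bounded_set (connected_component (~` trace (edges c)) p).
Proof.
move=> cc ins; have [N HN] := seq_bound c.
(* Inside squares have centres of norm at most N+1, and a point of a square is within 1/2 of the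
   centre in the maximum norm. *)
exists (N%:R + 2); split; first exact: num_real.
move=> M hM q /(component_inside cc); rewrite ins => /esym h; apply: le_trans (ltW hM).
have [h1 h2] := inside_bound cc HN h.
have [k1 k2] := square_of_in q.
rewrite prod_normE ge_max.
have K (x : R) (a : int) : `|a| <= N.+1%:Z -> `|x - a%:~R| <= 2^-1 -> `|x| <= N%:R + 2.
  move=> ha; rewrite !ler_norml => /andP[? ?].
  have : (a%:~R : R) <= (N.+1%:Z)%:~R by rewrite ler_int; move: ha; clear; lia.
  have : (- (N.+1%:Z))%:~R <= (a%:~R : R) by rewrite ler_int; move: ha; clear; lia.
  rewrite intrN -pmulrn -natr1 => ? ?.
  by apply/andP; split; lra.
by apply/andP; split; [apply: K h1 k1|apply: K h2 k2].
Qed.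

Lemma unbounded_outside c (p : plane) : simple_cycle c -> ~ trace (edges c) p ->
  ~~ inside c (square_of p) ->
  ~ bounded_set (connected_component (~` trace (edges c)) p).
Proof.
move=> cc np out /ex_strict_bound_gt0[M _ HM].
have [N HN] := outside_far cc.
(* [t] lies to the right of [c] and beyond the supposed bound [M]; being outside [c], it is linked
   to the square of [p]. *)
pose t : square := (N.+1%:Z + `|Num.ceil M|, 0).
have tN : N%:Z < t.1 by rewrite /=; move: (Num.ceil M); clear => m; lia.
have L : link c (square_of p) t.
  by apply: jordan => //; rewrite (negbTE out) (negbTE (HN t tN)).
have /HM : connected_component (~` trace (edges c)) p (center t).
  apply: connected_component_trans (component_link cc L).
  exact: component_center (square_of_in p).
rewrite /= prod_normE gt_max => /andP[+ _]; apply/negP; rewrite -leNgt /=.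
have h1 := ceil_ge M.
have h2 : ((Num.ceil M)%:~R : R) < t.1%:~R.
  by rewrite ltr_int /=; move: (Num.ceil M); clear => m; lia.
by apply: le_trans (ler_norm _); apply: le_trans h1 (ltW h2).
Qed.

Lemma interiorP c (p : plane) : simple_cycle c ->
  cycle_interior R (edges c) p <-> ~ trace (edges c) p /\ inside c (square_of p).
Proof.
move=> cc; split=> -[np h]; split => //; last exact: bounded_inside.
by apply: contrapT => /negP n; apply: unbounded_outside n h.
Qed.

Lemma exteriorP c (p : plane) : simple_cycle c ->
  cycle_exterior R (edges c) p <-> ~ trace (edges c) p /\ ~~ inside c (square_of p).
Proof.
move=> cc; split=> -[np h]; split => //; last exact: unbounded_outside.
by apply/negP => n; apply: h; apply: bounded_inside.
Qed.

Lemma open_square_center s : @open_square R s (center s).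
Proof. by split; rewrite /= subrr normr0; lra. Qed.

Lemma square_interiorP c s : simple_cycle c ->
  open_square s `<=` cycle_interior R (edges c) <-> inside c s.
Proof.
move=> cc; split=> [/(_ _ (open_square_center s))/(interiorP _ cc)[_]|ins p ps].
  by rewrite (square_of_open (open_square_center s)).
apply/(interiorP _ cc); split; first exact: open_square_trace ps.
by rewrite (square_of_open ps).
Qed.

Lemma square_exteriorP c s : simple_cycle c ->
  open_square s `<=` cycle_exterior R (edges c) <-> ~~ inside c s.
Proof.
move=> cc; split=> [/(_ _ (open_square_center s))/(exteriorP _ cc)[_]|ins p ps].
  by rewrite (square_of_open (open_square_center s)).
apply/(exteriorP _ cc); split; first exact: open_square_trace ps.
by rewrite (square_of_open ps).
Qed.

End Planar.

(** * From edge sets to vertex sequences and parity *)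

Lemma mem_edges c e : uniq c -> e \in edges c ->
  exists u v : vertex, e = [fset u; v]%fset /\ cedge c u v.
Proof.
move=> Uc /imfsetP[/= u uc ->]; exists u, (next c u); split => //.
by rewrite cedgeE // eqxx.
Qed.

Lemma vertices_edges c : uniq c -> vertices (edges c) =i c.
Proof.
move=> Uc v; apply/bigfcupP/idP => [[e /andP[he _]]|vc].
  have [u [w [-> uw]]] := mem_edges Uc he; have /andP[uc wc] := cedge_mem Uc uw.
  by rewrite !inE => /orP[] /eqP ->.
exists [fset v; next c v]%fset; last by rewrite !inE eqxx.
by rewrite andbT edgesE // cedgeE // eqxx.
Qed.

Lemma side_fset2 s u v : side s [fset u; v]%fset <-> corner s u && corner s v.
Proof.
split=> [h|/andP[su sv] w]; last by rewrite !inE => /orP[] /eqP ->.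
by rewrite !h // !inE eqxx ?orbT.
Qed.

Lemma edge_in_interiorP (R : realType) c u v : simple_cycle c ->
  edge_in_interior R (edges c) [fset u; v]%fset <->
  (forall s, corner s u -> corner s v -> inside c s).
Proof.
move=> cc; split=> h s.
  move=> su sv; apply/(square_interiorP R _ cc); apply: h.
  by apply/side_fset2; rewrite su.
by move=> /side_fset2/andP[su sv]; apply/(square_interiorP R _ cc); apply: h.
Qed.

Lemma edge_in_exteriorP (R : realType) c u v : simple_cycle c ->
  edge_in_exterior R (edges c) [fset u; v]%fset <->
  (forall s, corner s u -> corner s v -> ~~ inside c s).
Proof.
move=> cc; split=> h s.
  move=> su sv; apply/(square_exteriorP R _ cc); apply: h.
  by apply/side_fset2; rewrite su.
by move=> /side_fset2/andP[su sv]; apply/(square_exteriorP R _ cc); apply: h.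
Qed.

Lemma trace_edge (R : realType) c (p : R^o * R^o) : simple_cycle c -> trace (edges c) p ->
  exists u v, cedge c u v /\ forall s, corner s u -> corner s v -> in_square s p.
Proof.
move=> cc /(traceP _ cc).
have I (x y : int) : (x == y - 1) || (x == y) -> `|(x%:~R : R) + 2^-1 - y%:~R| <= 2^-1.
  by case/orP => /eqP ->; rewrite ?intrB ler_norml; apply/andP; split; lra.
case=> a [b [] [ca E /andP[h1 h2]]].
  exists (a, b), (a + 1, b); split => // -[s1 s2].
  rewrite /corner !inE /= => /andP[k1 k2] /andP[k3 k4].
  have -> : s1 = a + 1 by move: k1 k3; clear; lia.
  split; rewrite /= ?E; last exact: I.
  by rewrite ler_norml intrD; apply/andP; split; lra.
exists (a, b), (a, b + 1); split => // -[s1 s2].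
rewrite /corner !inE /= => /andP[k1 k2] /andP[k3 k4].
have -> : s2 = b + 1 by move: k2 k4; clear; lia.
split; rewrite /= ?E; first exact: I.
by rewrite ler_norml intrD; apply/andP; split; lra.
Qed.

(* A point of the interior of [c] on an edge of [f] would have a square outside [f],
   hence outside [c], on one of its sides. *)
Lemma interior_sub (R : realType) c f : simple_cycle c -> simple_cycle f ->
  (forall s, inside c s -> inside f s) ->
  cycle_interior R (edges c) `<=` cycle_interior R (edges f).
Proof.
move=> cc cf sub p /(interiorP _ cc)[np ins]; apply/(interiorP _ cf).
split; last exact: sub.
move=> /(trace_edge cf)[u [v [fuv H]]].
have A := cedge_adj cf fuv; have [h1 h2 h3 h4] := corner_left_square A.
have in_c s : in_square s p -> inside f s.
  by move=> hs; apply: sub; rewrite (inside_in_square cc np hs (square_of_in p)).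
by have := inside_left_square cf A; rewrite fuv !in_c //; apply: H.
Qed.

(** The edges of a cycle are those across which the parity changes. *)
Lemma edges_inside f g : simple_cycle f -> simple_cycle g ->
  inside f =1 inside g -> edges f = edges g.
Proof.
move=> cf cg E; have [_ _ Uf] := cf; have [_ _ Ug] := cg.
have K c d e : simple_cycle c -> simple_cycle d -> uniq c -> uniq d -> inside c =1 inside d ->
    e \in edges c -> e \in edges d.
  move=> cc cd Uc Ud Ecd /(mem_edges Uc)[u [v [-> cuv]]]; rewrite edgesE //.
  have A := cedge_adj cc cuv.
  by rewrite -(inside_left_square cd A) -!Ecd inside_left_square.
by apply/fsetP => e; apply/idP/idP; apply: K.
Qed.

(** * Existence and uniqueness of the outer cycle *)

Theorem theorem3 (R : realType) (C D : {fset edge})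
    (hC : is_cycle C) (hD : is_cycle D)
    (hCD : exists u v : vertex,
        [/\ u != v, u \in (vertices C `&` vertices D)%fset
          & v \in (vertices C `&` vertices D)%fset]) :
  exists E : {fset edge},
    unique (fun F : {fset edge} =>
      [/\ is_cycle F,
          (F `<=` C `|` D)%fset,
          cycle_interior R C `|` cycle_interior R D `<=` cycle_interior R F
        & forall e : edge, e \in (C `|` D)%fset ->
            e \in F \/ edge_in_interior R F e]) E /\
    ((exists e : edge, e \in D /\ edge_in_exterior R C e) ->
     exists e : edge, [/\ e \in E, e \in D & edge_in_exterior R C e]).
Proof.
have [c cc Ec] := (is_cycleP C).1 hC; have [d cd Ed] := (is_cycleP D).1 hD; subst C D.
have [_ _ Uc] := cc; have [_ _ Ud] := cd.
have hcd : exists u v : vertex, [/\ u != v, u \in c, v \in c, u \in d & v \in d].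
  case: hCD => u [v [nuv]]; rewrite !in_fsetI !vertices_edges //.
  by move=> /andP[? ?] /andP[? ?]; exists u, v.
(* Property (ii) in terms of parity. By [inside_sub], a cycle with it encloses every cycle drawn on
   [c] and [d]: these two themselves for (i), a rival cycle for uniqueness. *)
pose cover f := forall u v s, cedge c u v \/ cedge d u v -> ~~ cedge f u v ->
  corner s u -> corner s v -> inside f s.
have cover_sub f g : simple_cycle f -> simple_cycle g ->
    (forall u v, cedge g u v -> cedge c u v \/ cedge d u v) -> cover f ->
    forall s, inside g s -> inside f s.
  by move=> cf cg gcd hf; apply: inside_sub => // u v s /gcd; apply: hf.
have [f [cf fcd hf]] := exists_max cc cd hcd; have [_ _ Uf] := cf.
have cf_sub s : inside c s -> inside f s by apply: cover_sub => // u v; left.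
have df_sub s : inside d s -> inside f s by apply: cover_sub => // u v; right.
exists (edges f); split; first split.
- split.
  + by apply/is_cycleP; exists f.
  + apply/fsubsetP => e /(mem_edges Uf)[u [v [-> /fcd]]].
    by rewrite in_fsetU !edgesE // => -[] ->; rewrite ?orbT.
  + by move=> p [|]; apply: interior_sub.
  + move=> e; have K (u v : vertex) : cedge c u v \/ cedge d u v -> [fset u; v]%fset \in edges f \/
        edge_in_interior R (edges f) [fset u; v]%fset.
      move=> cduv; have [h|n] := boolP (cedge f u v); first by left; rewrite edgesE.
      by right; apply/edge_in_interiorP => // s; apply: hf.
    rewrite in_fsetU => /orP[/(mem_edges Uc)|/(mem_edges Ud)] [u [v [-> h]]]; apply: K.
      by left.
    by right.
- move=> G [/is_cycleP[g cg ->] gcd _ hg]; have [_ _ Ug] := cg.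
  have {}gcd u v : cedge g u v -> cedge c u v \/ cedge d u v.
    rewrite -edgesE // => /(fsubsetP gcd); rewrite in_fsetU !edgesE //.
    by move/orP.
  have {}hg : cover g.
    move=> u v s cduv n; case: (hg [fset u; v]%fset).
    + by rewrite in_fsetU !edgesE //; apply/orP.
    + by rewrite edgesE // (negbTE n).
    + by move/(edge_in_interiorP _ _ _ cg); apply.
  (* Both cycles have property (ii), so each encloses the other. *)
  apply: edges_inside => // s; apply/idP/idP.
    exact: cover_sub s.
  exact: cover_sub s.
- move=> [e [/(mem_edges Ud)[u [v [-> duv]]]]] /(edge_in_exteriorP _ _ _ cc) ext.
  have A := cedge_adj cd duv; have [h1 h2 _ _] := corner_left_square A.
  (* If [f] had only edges of [c], all squares inside [f] would be inside [c]. But [uv] is on [f],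
     hence on [c], or inside [f], hence inside [c]; either way one of its sides is inside [c]. *)
  have [a [b [fab ncab]]] : exists a b, cedge f a b /\ ~~ cedge c a b.
    apply: contrapT => H.
    have fc a b : cedge f a b -> cedge c a b.
      by move=> fab; apply: contrapT => /negP ncab; apply: H; exists a, b.
    have fc_sub : forall s, inside f s -> inside c s.
      by apply: inside_sub => // a b s /fc ->.
    have [fuv|nfuv] := boolP (cedge f u v).
      have := inside_left_square cc A; rewrite (fc _ _ fuv).
      by rewrite !(negbTE (ext _ _ _)) //; case: (corner_left_square A).
    have := ext _ h1 h2; rewrite fc_sub //; apply: hf h1 h2 => //.
    by right.
  have Aab := cedge_adj cf fab; have [k1 k2 k3 k4] := corner_left_square Aab.
  exists [fset a; b]%fset; rewrite !edgesE //; split => //.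
    by case: (fcd _ _ fab) => // cab; rewrite cab in ncab.
  apply/edge_in_exteriorP => // s sa sb.
  (* One side of [ab] is outside [f], hence outside [c]; since [ab] is not on [c], so is the other
     side. *)
  have : ~~ inside f (left_square a b) || ~~ inside f (left_square b a).
    by have := inside_left_square cf Aab; rewrite fab; case: (inside _ _); case: (inside _ _).
  case/orP => nf; apply: contra nf => cs; apply: cf_sub.
    by rewrite -(sides_same cc Aab ncab sa sb k1 k2).
  by rewrite -(sides_same cc Aab ncab sa sb k3 k4).
Qed.
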